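(* Let $\beta,\mu$ be positive reals with $\beta+2\sqrt{\mu}\le\frac{1}{1200}$. Let $G$ be an $n$-vertex graph with minimum degree at least $\frac{n}{5}$ and at least $\binom{n}{2}-\beta n^2$ edges, and let $\mathcal{F}$ be a $\mu n$-bounded incompatibility system over $G$. Then for every edge $e$ of $G$ there exists a Hamilton cycle of $G$ containing $e$ that is compatible with $\mathcal{F}$.
   Context: All graphs are finite and simple. An incompatibility system $\mathcal{F}$ over $G=(V,E)$ is a family $\{F_v\}_{v\in V}$ where each $F_v$ is a set of unordered pairs $\{e,e'\}$ of distinct edges with $e\cap e'=\{v\}$; edges $e,e'$ are incompatible if $\{e,e'\}\in F_v$ for some $v$, compatible otherwise. A cycle is compatible with $\mathcal{F}$ if every pair of its edges is compatible. For a positive real $\Delta$, $\mathcal{F}$ is $\Delta$-bounded if for every vertex $v$ and edge $e\ni v$, at most $\Delta$ other edges $e'\ni v$ satisfy $\{e,e'\}\in F_v$.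
   Formalization: The graph is assumed to have n ≥ 3 vertices: for n = 2 the graph K2 with the empty incompatibility system meets all hypotheses but has no Hamilton cycle. *)

(* Defs.v *)
From HB Require Import structures.
From mathcomp Require Import all_boot all_order all_algebra.
From mathcomp Require Import reals.
Set Implicit Arguments. Unset Strict Implicit. Unset Printing Implicit Defensive.
Import Order.TTheory GRing.Theory Num.Theory.

Definition simple_graph (T : finType) (E : {set {set T}}) : Prop :=
  forall e, e \in E -> #|e| = 2.

Definition deg (T : finType) (E : {set {set T}}) (v : T) : nat :=
  #|[set e in E | v \in e]|.

(* An incompatibility system: F v e e' means {e,e'} \in F_v.  Pairs are
   unordered: the pair {e,e'} is in F_v iff F v e e' || F v e' e. *)
Definition incompat_system (T : finType) (E : {set {set T}})
  (F : T -> rel {set T}) : Prop :=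
  forall v e e', F v e e' ->
    [/\ e \in E, e' \in E, e != e' & e :&: e' = [set v]].

Definition in_F (T : finType) (F : T -> rel {set T}) (v : T) (e e' : {set T}) : bool :=
  F v e e' || F v e' e.

Definition incompatible (T : finType) (F : T -> rel {set T}) (e e' : {set T}) : bool :=
  [exists v, in_F F v e e'].

Definition bounded (R : realType) (T : finType) (E : {set {set T}})
  (F : T -> rel {set T}) (Delta : R) : Prop :=
  forall v e, e \in E -> v \in e ->
    ((#|[set e' in E | (v \in e') && (e' != e) && in_F F v e e']|)%:R <= Delta)%R.

Definition cycle_edges (T : finType) (c : seq T) : {set {set T}} :=
  [set [set x; next c x] | x in c].

Definition hamilton_cycle (T : finType) (E : {set {set T}}) (c : seq T) : Prop :=
  [/\ uniq c, (forall v : T, v \in c), 3 <= size c &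
      cycle (fun x y => [set x; y] \in E) c].

Definition compatible_cycle (T : finType) (F : T -> rel {set T}) (c : seq T) : Prop :=
  forall e e', e \in cycle_edges c -> e' \in cycle_edges c -> ~~ incompatible F e e'.

(* Main.v *)
Require Import Defs.
From HB Require Import structures.
From mathcomp Require Import all_boot all_order all_algebra.
From mathcomp Require Import reals.
From mathcomp Require Import zify lra.
Import Order.TTheory GRing.Theory Num.Theory.
Set Implicit Arguments. Unset Strict Implicit. Unset Printing Implicit Defensive.

(** Let n be the number of vertices, and call (a, b, c) good if ab and bc are
    compatible edges.

    If n < 10^5, then mu n < 1 and no two edges are incompatible.  In this case
    all but n/120 vertices have degree at least 3n/4, and repeatedly joining
    two nonadjacent vertices of degree sum at least n + 2 completes the graph;
    the Bondy-Chvatal 2-opt exchange undoes each step while keeping a Hamilton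
    path between the ends of the prescribed edge.

    If n >= 10^5, grow a compatible path greedily from the prescribed edge to
    3n/20 vertices and close it up with two further vertices.  A compatible
    cycle C on at least 3n/20 vertices is then enlarged one vertex at a time:
    some x outside C has at least n/10 neighbours on C.  Cut C at a random edge
    wz, so that it reads z ... y- y y+ ... y'- y' y'+ ... w with y, y' random
    neighbours of x, and rearrange it to
        y- ... z y x y' w ... y'+ y+ ... y'- (y-).
    Every new edge and every new consecutive triple depends on two of z, y, y'
    and is bad for few of their values on average;
    the point of drawing z at random too is that a fixed edge xy might be
    incompatible with both cycle edges at y, for every y.  Only O(beta + mu) of
    the choices (z, y, y') are bad, so a good one exists. *)

Local Open Scope nat_scope.

(** * Sequences and cycles of good triples *)

Section CyclicTriples.
Variables (T : eqType) (x0 : T) (ok : T -> T -> T -> bool).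
Hypothesis ok_sym : forall a b c, ok a b c = ok c b a.

Fixpoint tri (s : seq T) : bool :=
  if s is a :: s1 then
    (if s1 is b :: c :: _ then ok a b c else true) && tri s1
  else true.

(** A window of three consecutive entries cannot reach across the pair [a], [b], so two pieces
    overlapping in these two entries contain every window. *)
Lemma tri_cat2 s a b t :
  tri (s ++ a :: b :: t) = tri (s ++ [:: a; b]) && tri (a :: b :: t).
Proof.
elim: s => [|u s IHs] //.
have -> r : tri ((u :: s) ++ r) =
  (if s ++ r is b :: c :: _ then ok u b c else true) && tri (s ++ r) by [].
rewrite IHs andbA; congr (_ && _ && _).
by case: s {IHs} => [|? [|]].
Qed.

Lemma tri_rev s : tri (rev s) = tri s.
Proof.
elim: s => [|a [|b [|c s]] IHs] //.
rewrite 3!rev_cons -!cats1 -!catA /= tri_cat2.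
rewrite 2!rev_cons -!cats1 -!catA in IHs.
by rewrite IHs /= andbT andbC ok_sym.
Qed.

Lemma tri_drop k s : tri s -> tri (drop k s).
Proof. by elim: s k => [|a s IHs] [|k] //= /andP[_ /IHs]. Qed.

Lemma tri_take k s : tri s -> tri (take k s).
Proof. by rewrite -tri_rev -(tri_rev (take k s)) rev_take; apply: tri_drop. Qed.

Lemma tri_cat s t : 1 < size s -> 1 < size t ->
  tri (s ++ t) =
  [&& tri s, ok (nth x0 (rev s) 1) (nth x0 (rev s) 0) (nth x0 t 0),
      ok (nth x0 (rev s) 0) (nth x0 t 0) (nth x0 t 1) & tri t].
Proof.
case: t => [|c [|d t]] //.
elim/last_ind: s => [|s b _] //; elim/last_ind: s => [|s a _] // _ _.
rewrite -!cats1 -!catA /= tri_cat2 !rev_cat /=.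
by case: t => [|e t]; rewrite /= ?andbT ?andbA.
Qed.

(** Entries 0 and 1 of [rev s] are the last and the last but one of [s]; the two extra conditions
    are the windows that wrap around. *)
Definition tricycle (s : seq T) : bool :=
  [&& tri s, ok (nth x0 (rev s) 1) (nth x0 (rev s) 0) (nth x0 s 0) &
      ok (nth x0 (rev s) 0) (nth x0 s 0) (nth x0 s 1)].

Lemma tricycle_rot1 s : 2 < size s -> tricycle s -> tricycle (rot 1 s).
Proof.
case: s => [|a s] //= sz.
have [d [e [r def_s]]] : exists d e r, s = rcons (rcons r d) e.
  case/lastP: s sz => [|s e] //; case/lastP: s => [|r d] // _.
  by exists d, e, r.
have [b [c [t def_s']]] : exists b c t, s = b :: c :: t.
  by case: s sz {def_s} => [|b [|c t]] // _; exists b, c, t.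
have -> : tricycle (a :: s) = [&& tri (a :: s), ok d e a & ok e a b].
  by rewrite /tricycle rev_cons {2 3 5}def_s !rev_rcons def_s'.
have -> : tricycle (rot 1 (a :: s)) = [&& tri (rcons s a), ok e a b & ok a b c].
  by rewrite /tricycle rot1_cons rev_rcons {2}def_s rev_rcons def_s'.
have -> : tri (rcons s a) = tri s && ok d e a.
  by rewrite def_s -!cats1 -!catA tri_cat2 /= andbT.
have -> : tri (a :: s) = ok a b c && tri s by rewrite def_s'.
by case/and3P=> /andP[-> ->] -> ->.
Qed.

Lemma tricycle_rot k s : 2 < size s -> tricycle s -> tricycle (rot k s).
Proof.
move=> sz trs; have [le_sk|lt_ks] := leqP (size s) k; first by rewrite rot_oversize.
elim: k lt_ks => [|k IHk] lt_ks; first by rewrite rot0.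
rewrite -addn1 addnC rotD ?add1n //; last exact: ltnW.
by apply: tricycle_rot1; rewrite ?size_rot // IHk // ltnW.
Qed.

Lemma next_nth_S s i : uniq s -> i.+1 < size s ->
  next s (nth x0 s i) = nth x0 s i.+1.
Proof.
move=> Us lt_is; rewrite next_nth mem_nth ?(ltnW lt_is) //.
case: s Us lt_is => [|a s] // Us lt_is.
by rewrite index_uniq ?(ltnW lt_is) //=; apply: set_nth_default.
Qed.

Lemma prev_nth_S s i : uniq s -> i.+1 < size s ->
  prev s (nth x0 s i.+1) = nth x0 s i.
Proof. by move=> Us lt_is; rewrite -next_nth_S // prev_next. Qed.

Lemma prev_nth0 s : uniq s -> prev s (nth x0 s 0) = nth x0 s (size s).-1.
Proof.
move=> Us; case: s Us => [|a s] // /andP[nas _]; rewrite prev_nth mem_head memNindex //=.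
by rewrite -last_nth nth_last.
Qed.

(** Rotating [v] to the front turns the claim into the second wrap-around window. *)
Lemma tricycle_at s v : uniq s -> 2 < size s -> tricycle s -> v \in s ->
  ok (prev s v) v (next s v).
Proof.
move=> Us sz trs vs.
have := tricycle_rot (index v s) sz trs.
rewrite -(prev_rot (index v s) Us) -(next_rot (index v s) Us).
have: uniq (rot (index v s) s) by rewrite rot_uniq.
have: 2 < size (rot (index v s) s) by rewrite size_rot.
have: nth x0 (rot (index v s) s) 0 = v.
  by rewrite /rot (drop_nth x0) ?index_mem //= nth_index.
move: (rot _ s) => r <- szr Ur /and3P[_ _].
rewrite prev_nth0 // next_nth_S ?nth_rev //; try lia.
by rewrite subn1.
Qed.

(* Write c = s1 y s2 y' s3 with y, y' at positions i, j; the new cycle is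
   s2 (rev s1) y x y' (rev s3). *)
Lemma tricycle_switch c x i j : 1 < i -> i + 3 <= j -> j + 3 <= size c ->
  tri c ->
  let v := nth x0 c in let k := size c in
  ok (v 1) (v 0) (v i) -> ok (v 0) (v i) x -> ok (v i) x (v j) ->
  ok x (v j) (v k.-1) -> ok (v j) (v k.-1) (v k.-2) ->
  ok (v j.+2) (v j.+1) (v i.+1) -> ok (v j.+1) (v i.+1) (v i.+2) ->
  ok (v j.-2) (v j.-1) (v i.-1) -> ok (v j.-1) (v i.-1) (v i.-2) ->
  exists c', tricycle c' /\ perm_eq c' (x :: c).
Proof.
move=> i_gt1 le_ij le_jk tric v k.
pose s1 := take i c; pose s2 := take (j - i.+1) (drop i.+1 c).
pose s3 := drop j.+1 c.
have sz1 : size s1 = i by rewrite size_take; case: ifP; lia.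
have sz2 : size s2 = j - i.+1 by rewrite size_take size_drop; case: ifP; lia.
have sz3 : size s3 = k - j.+1 by rewrite size_drop.
have def_c : c = s1 ++ v i :: s2 ++ v j :: s3.
  rewrite -[LHS](cat_take_drop i); congr (_ ++ _).
  rewrite (drop_nth x0) ?(leq_trans _ le_jk) //; last lia.
  congr (_ :: _); rewrite -[LHS](cat_take_drop (j - i.+1)); congr (_ ++ _).
  rewrite drop_drop (_ : _ - _ + _ = j); last lia.
  by rewrite (drop_nth x0) //; lia.
have n1 t : t < i -> nth x0 s1 t = v t by move=> lt; rewrite nth_take.
have n2 t : t < j - i.+1 -> nth x0 s2 t = v (i.+1 + t).
  by move=> lt; rewrite nth_take // nth_drop.
have n3 t : nth x0 s3 t = v (j.+1 + t) by rewrite nth_drop.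
have [t1 t2 t3] : [/\ tri s1, tri s2 & tri s3].
  by rewrite /s1 /s2 /s3 !(tri_take, tri_drop).
pose c' := s2 ++ rev s1 ++ [:: v i; x; v j] ++ rev s3.
have perm_c' : perm_eq c' (x :: c).
  rewrite [in x :: c]def_c /c'.
  apply/permP => P; rewrite !(count_cat, count_rev) /= !count_cat /= !count_cat /=.
  move: (count P s1) (count P s2) (count P s3) (nat_of_bool (P x)) => n_1 n_2 n_3 n_x.
  move: (nat_of_bool (P (v i))) (nat_of_bool (P (v j))) => n_i n_j; clear; lia.
have szr1 : size (rev s1) = i by rewrite size_rev.
have szr3 : size (rev s3) = k - j.+1 by rewrite size_rev.
have sz4 : size ([:: v i; x; v j] ++ rev s3) = 3 + (k - j.+1) by rewrite size_cat szr3.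
have sz5 : size (rev s1 ++ [:: v i; x; v j] ++ rev s3) = i + (3 + (k - j.+1)).
  by rewrite size_cat szr1 sz4.
have catl s t l : l < size s -> nth x0 (s ++ t) l = nth x0 s l.
  by rewrite nth_cat => ->.
have h1 l : l < i -> nth x0 (rev s1) l = v (i - l.+1).
  by move=> lt; rewrite nth_rev ?sz1 // n1 //; clear -lt i_gt1; lia.
have h2 l : l < j - i.+1 -> nth x0 (rev s2) l = v (j - l.+1).
  move=> lt; rewrite nth_rev ?sz2 // n2; last by clear -lt; lia.
  by congr (v _); clear -lt; lia.
have h3 l : l < k - j.+1 -> nth x0 (rev s3) l = v (k - l.+1).
  by move=> lt; rewrite nth_rev ?sz3 // n3; congr (v _); clear -lt; lia.
(* The gaps assumed between 0, [i], [j] and [k] give each segment at least two entries, as [tri_cat]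
   requires. *)
have [lt_i1 lt_j1 lt_k1] : [/\ 1 < i, 1 < j - i.+1 & 1 < k - j.+1].
  by rewrite /k; clear -i_gt1 le_ij le_jk; split; lia.
have [lt_i0 lt_j0 lt_k0] := And3 (ltnW lt_i1) (ltnW lt_j1) (ltnW lt_k1).
(* Windows inside the three segments come from [tri c]. There remain the window centred at [x] and
   two windows at each of the four places, the wrap-around included, where blocks meet. *)
have tri_c' : tricycle c' =
  [&& ok (v j.-2) (v j.-1) (v i.-1), ok (v j.-1) (v i.-1) (v i.-2),
      ok (v 1) (v 0) (v i), ok (v 0) (v i) x, ok (v i) x (v j),
      ok x (v j) (v k.-1), ok (v j) (v k.-1) (v k.-2),
      ok (v j.+2) (v j.+1) (v i.+1) & ok (v j.+1) (v i.+1) (v i.+2)].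
  rewrite /tricycle !tri_cat ?sz5 ?sz4 ?szr1 ?szr3 ?sz2 //; last first.
    by clear -lt_i0; lia.
  rewrite !tri_rev t1 t2 t3 !rev_cat !revK -!catA.
  rewrite !(catl _ _ 0) ?(szr1, sz2, sz3) // !(catl _ _ 1) ?(szr1, sz2, sz3) //.
  rewrite !h1 ?h2 ?h3 ?n1 ?n2 ?n3 //.
  rewrite !(addn0, addn1, subn1, subn2) /=.
  by rewrite !andbT -!andbA.
move=> H1 H2 H3 H4 H5 H6 H7 H8 H9.
by exists c'; rewrite tri_c' H1 H2 H3 H4 H5 H6 H7 H8 H9.
Qed.

End CyclicTriples.

(** * Counting pairs *)

Lemma sum_card (T : finType) (P : pred T) : \sum_(b : T) P b = #|[set b | P b]|.
Proof. by rewrite -sum1dep_card [RHS]big_mkcond; apply: eq_bigr => b _; case: (P b). Qed.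

Section PairCount.
Variable T : finType.
Implicit Types (R : rel T) (f g : T -> T) (A B : {set T}).

Definition npairs R : nat := \sum_(a : T) \sum_(b : T) R a b.

Lemma npairs_or R1 R2 :
  npairs (fun a b => R1 a b || R2 a b) <= npairs R1 + npairs R2.
Proof.
rewrite /npairs -big_split leq_sum // => a _.
by rewrite -big_split leq_sum // => b _; case: (R1 a b); case: (R2 a b).
Qed.

Lemma npairs_or_le R1 R2 k1 k2 :
  npairs R1 <= k1 -> npairs R2 <= k2 ->
  npairs (fun a b => R1 a b || R2 a b) <= k1 + k2.
Proof. by move=> le1 le2; rewrite (leq_trans (npairs_or _ _)) ?leq_add. Qed.

Lemma npairs_ltn R R' u v :
  (forall a b, R' a b -> R a b) -> R u v -> ~~ R' u v -> npairs R' < npairs R.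
Proof.
have cardE (Q : rel T) : npairs Q = #|[set w | Q w.1 w.2]|.
  by rewrite /npairs pair_bigA /= sum_card.
move=> sub Ruv nR'uv; rewrite !cardE; apply: proper_card; apply/properP; split.
  by apply/subsetP => w; rewrite !inE; apply: sub.
by exists (u, v); rewrite !inE.
Qed.

Lemma npairs_swap R : npairs (fun a b => R b a) = npairs R.
Proof. by rewrite /npairs exchange_big. Qed.

Lemma npairs_inj R f g : injective f -> injective g ->
  npairs (fun a b => R (f a) (g b)) = npairs R.
Proof.
move=> inj_f inj_g; rewrite /npairs [RHS](reindex_inj inj_f); apply: eq_bigr => a _.
by rewrite [RHS](reindex_inj inj_g).
Qed.

Lemma npairs_le R m : (forall a, #|[set b | R a b]| <= m) ->
  npairs R <= #|T| * m.
Proof.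
move=> leRm; rewrite -sum_nat_const leq_sum // => a _.
by rewrite sum_card leRm.
Qed.

Lemma npairs_fun f : npairs (fun a b => b == f a) <= #|T|.
Proof.
rewrite -[leqRHS]muln1; apply: npairs_le => a.
by rewrite (_ : [set b | b == f a] = [set f a]) ?cards1 //; apply/setP => b; rewrite !inE.
Qed.

Lemma npairs_ge R A k : (forall a, a \in A -> k <= #|[set b | R a b]|) ->
  #|A| * k <= npairs R.
Proof.
move=> leR; rewrite /npairs -sum_nat_const.
rewrite [leqRHS](bigID (mem A)) /= (leq_trans _ (leq_addr _ _)) //.
by apply: leq_sum => a Aa; rewrite sum_card leR.
Qed.

Lemma npairs_partition R1 R2 R3 :
  (forall a b, R1 a b + R2 a b + R3 a b = 1) ->
  npairs R1 + npairs R2 + npairs R3 = #|T| * #|T|.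
Proof.
move=> sum1; rewrite /npairs -!big_split -sum_nat_const; apply: eq_bigr => a _.
rewrite -!big_split /= -[RHS]muln1 -sum_nat_const; apply: eq_bigr => b _.
exact: sum1.
Qed.

(** Union bound over U × D × D: if every triple were hit, then u d^2 <= 2 d q1 + u q2, where q1 and
    q2 count the pairs in [Q1] and [Q2]; but the right side is below (6/10 + 4/10) u d^2. *)
Lemma triple_exists (U D : {set T}) (Q1 Q2 : rel T) : 0 < #|U| ->
  10 * npairs Q1 <= 3 * (#|U| * #|D|) -> 10 * npairs Q2 < 4 * (#|D| * #|D|) ->
  exists z y y', [/\ z \in U, y \in D & y' \in D] /\
    [/\ ~~ Q1 z y, ~~ Q1 z y' & ~~ Q2 y y'].
Proof.
move=> U_gt0 leQ1 ltQ2; set u := #|U| in U_gt0 leQ1; set d := #|D| in leQ1 ltQ2.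
case: (boolP [exists z in U, [exists y in D, [exists y' in D,
  [&& ~~ Q1 z y, ~~ Q1 z y' & ~~ Q2 y y']]]]) => [|noT].
  case/exists_inP => z Uz /exists_inP[y Dy] /exists_inP[y' Dy'] /and3P[? ? ?].
  by exists z, y, y'.
have allQ z y y' : z \in U -> y \in D -> y' \in D ->
    1 <= Q1 z y + Q1 z y' + Q2 y y'.
  move=> Uz Dy Dy'; apply: contraR noT; rewrite -ltnNge ltnS leqn0.
  rewrite !addn_eq0 !eqb0 -andbA => Q.
  by apply/exists_inP; exists z => //; apply/exists_inP; exists y => //;
     apply/exists_inP; exists y'.
have le_sub R' (A B : {set T}) : \sum_(a in A) \sum_(b in B) R' a b <= npairs R'.
  rewrite /npairs [leqRHS](bigID (mem A)) /= (leq_trans _ (leq_addr _ _)) //.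
  apply: leq_sum => a _; rewrite [leqRHS](bigID (mem B)) /=.
  by rewrite (leq_trans _ (leq_addr _ _)).
have: u * d * d <= d * npairs Q1 + d * npairs Q1 + u * npairs Q2.
  have -> : u * d * d = \sum_(z in U) \sum_(y in D) \sum_(y' in D) 1.
    under eq_bigr do (under eq_bigr do rewrite sum1_card; rewrite sum_nat_const).
    by rewrite sum_nat_const mulnA.
  apply: (@leq_trans (\sum_(z in U) \sum_(y in D) \sum_(y' in D)
            (Q1 z y + Q1 z y' + Q2 y y'))).
    apply: leq_sum => z Uz; apply: leq_sum => y Dy; apply: leq_sum => y' Dy'.
    exact: allQ.
  under eq_bigr do (under eq_bigr do rewrite !big_split /= sum_nat_const;
    rewrite !big_split /= -big_distrr /= sum_nat_const).
  rewrite !big_split /= -!big_distrr /= sum_nat_const.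
  by rewrite !leq_add // leq_mul2l le_sub orbT.
move=> H; exfalso.
have H1 := leq_mul (leqnn d) leQ1.
have H2 : u * (10 * npairs Q2) < u * (4 * (d * d)) by rewrite ltn_pmul2l.
move: H H1 H2; move: (npairs Q1) (npairs Q2) => q1 q2.
by clear; nia.
Qed.

End PairCount.

(** * Enlarging compatible cycles *)

Section Extension.
Variables (T : finType) (adj : rel T) (bad : T -> T -> T -> bool) (p q : T) (m : nat).
Let n := #|T|.
Hypothesis adj_sym : symmetric adj.
Hypothesis bad_sym : forall b a c, bad b a c = bad b c a.
Hypothesis bad_le : forall b a, #|[set c | bad b a c]| <= m.
Hypothesis nonadj_le : 600 * npairs (fun a b => ~~ adj a b) <= n * n + 600 * n.
Hypothesis deg_ge : forall a, n <= 5 * #|[set b | adj a b]|.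
Hypothesis n_large : 100 * 1000 <= n.
Hypothesis m_small : 100 * (1000 * m) <= n.

(* The last clause forces the edge pq into any cycle of good triples through p. *)
Definition triple_ok a b c :=
  [&& adj a b, adj b c, ~~ bad b a c & (b == p) ==> (a == q) || (c == q)].

Lemma triple_ok_sym a b c : triple_ok a b c = triple_ok c b a.
Proof.
by rewrite /triple_ok !(adj_sym b) bad_sym andbCA [(a == q) || _]orbC !(adj_sym _ b).
Qed.

Lemma triple_okI a b c : adj a b -> adj b c -> ~~ bad b a c -> b != p -> triple_ok a b c.
Proof. by rewrite /triple_ok => -> -> -> /negPf->. Qed.

(** Applies [tricycle_switch] to [c] cut between [prev c z] and [z]. Each obstruction involves only
    two of [z], [y], [y']: [Q1] collects those with [z], [Q2] those with [y] and [y'], so it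
    suffices to count pairs. *)
Lemma cycle_extend c x : uniq c -> tricycle p triple_ok c -> p \in c ->
  3 * n <= 20 * size c -> x \notin c ->
  n <= 10 * #|[set y | adj x y && (y \in c)]| ->
  exists c', [/\ uniq c', tricycle p triple_ok c' & perm_eq c' (x :: c)].
Proof.
move=> Uc tc pc sz_c xc dx.
have n_large' := n_large.
have sz_gt2 : 2 < size c by clear -sz_c n_large'; lia.
have idI : injective (@id T) by [].
pose nx := next c; pose pv := prev c.
have nxK : cancel nx pv := prev_next Uc.
have pvK : cancel pv nx := next_prev Uc.
have inj_nx := can_inj nxK; have inj_pv := can_inj pvK.
(* The new triples are centred at [x], [z], [pv z], and at [y], [y'] and their neighbours on the
   cycle. The deletions keep [p] off all these centres, so the edge [pq] survives. *)
pose U := [set z in c] :\ p :\ nx p.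
pose D := [set y | adj x y && (y \in c)] :\ p :\ nx p :\ pv p.
(* [Q1] treats [y] in both roles, as the first and as the second neighbour of [x] met after [z],
   because the order of the two is not yet known. Its last four clauses and the last five of [Q2]
   supply the index gaps. *)
pose Q1 : rel T := fun z y => ~~ adj z y || (~~ adj (pv z) y || (bad z (nx z) y ||
  (bad y z x || (bad y x (pv z) || (bad (pv z) (pv (pv z)) y ||
  ((y == z) || ((y == nx z) || ((y == pv z) || (y == pv (pv z)))))))))).
pose Q2 : rel T := fun y y' => ~~ adj (nx y) (nx y') || (~~ adj (pv y) (pv y') ||
  (bad x y y' || (bad (nx y') (nx (nx y')) (nx y) || (bad (nx y) (nx (nx y)) (nx y') ||
  (bad (pv y') (pv (pv y')) (pv y) || (bad (pv y) (pv (pv y)) (pv y') ||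
  ((y' == y) || ((y' == nx y) || ((y' == nx (nx y)) || ((y == nx y') || (y == nx (nx y')))))))))))).
have [z [y [y' [[Uz Dy Dy'] [Q1y Q1y' Q2yy']]]]] : exists z y y',
    [/\ z \in U, y \in D & y' \in D] /\ [/\ ~~ Q1 z y, ~~ Q1 z y' & ~~ Q2 y y'].
  have cardD1 (A : {set T}) a : #|A| <= #|A :\ a|.+1.
    by rewrite (cardsD1 a A); case: (a \in A).
  have szc : #|[set z in c]| = size c by rewrite cardsE; apply/card_uniqP.
  have leU : size c <= #|U| + 2.
    have := cardD1 ([set z in c] :\ p) (nx p); have := cardD1 [set z in c] p.
    by rewrite szc -/U; clear; lia.
  have leD : n <= 10 * (#|D| + 3).
    have := cardD1 ([set y | adj x y && (y \in c)] :\ p :\ nx p) (pv p).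
    have := cardD1 ([set y | adj x y && (y \in c)] :\ p) (nx p).
    have := cardD1 [set y | adj x y && (y \in c)] p.
    rewrite -/D; move: dx; clear; lia.
  pose N := npairs (fun a b => ~~ adj a b).
  have leQ1 : npairs Q1 <= N + (N + (n * m + (n * m + (n * m + (n * m +
      (n + (n + (n + n)))))))).
    apply: npairs_or_le => //; apply: npairs_or_le.
      by rewrite (npairs_inj (fun a b => ~~ adj a b) inj_pv idI).
    apply: npairs_or_le; first by apply: npairs_le => a; apply: bad_le.
    apply: npairs_or_le.
      (* Here the edge [xy] is fixed and the cut varies: each [y] excludes at most [m] values of
         [z], hence the exchange of coordinates. *)
      rewrite -npairs_swap; apply: npairs_le => a; apply: leq_trans (bad_le a x); apply: subset_leq_card.
      by apply/subsetP => b; rewrite !inE bad_sym.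
    apply: npairs_or_le.
      rewrite -npairs_swap (npairs_inj (fun a b => bad a x b) idI inj_pv).
      by apply: npairs_le => a; apply: bad_le.
    apply: npairs_or_le; first by apply: npairs_le => a; apply: bad_le.
    do 3![apply: npairs_or_le; first exact: npairs_fun].
    exact: npairs_fun.
  have leQ2 : npairs Q2 <= N + (N + (n * m + (n * m + (n * m + (n * m + (n * m +
      (n + (n + (n + (n + n)))))))))).
    have le_bad (f g h : T -> T) : injective h -> npairs (fun a b => bad (f a) (g a) (h b)) <= n * m.
      move=> inj_h; rewrite (npairs_inj (fun a b => bad (f a) (g a) b) idI inj_h).
      by apply: npairs_le => a; apply: bad_le.
    apply: npairs_or_le; first by rewrite (npairs_inj (fun a b => ~~ adj a b) inj_nx inj_nx).
    apply: npairs_or_le; first by rewrite (npairs_inj (fun a b => ~~ adj a b) inj_pv inj_pv).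
    apply: npairs_or_le; first exact: (le_bad (fun=> x) id id idI).
    apply: npairs_or_le.
      by rewrite -npairs_swap; apply: (le_bad nx (nx \o nx) nx inj_nx).
    apply: npairs_or_le; first exact: (le_bad nx (nx \o nx) nx inj_nx).
    apply: npairs_or_le.
      by rewrite -npairs_swap; apply: (le_bad pv (pv \o pv) pv inj_pv).
    apply: npairs_or_le; first exact: (le_bad pv (pv \o pv) pv inj_pv).
    do 3![apply: npairs_or_le; first exact: npairs_fun].
    apply: npairs_or_le; first by rewrite -npairs_swap npairs_fun.
    by rewrite -npairs_swap (npairs_fun (nx \o nx)).
  have nm := leq_mul (leqnn n) m_small.
  have nn := leq_mul (leqnn n) n_large.
  (* These are 3n/20 and n/10 less the deleted vertices, rounded down. In both counts the main term
     is 20 N, about n^2/30, against 3 |U||D| >= 0.044 n^2 and 4 |D|^2 >= 0.039 n^2. *)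
  have leU' : 149 * n <= 1000 * #|U| by clear -leU sz_c n_large'; lia.
  have leD' : 99 * n <= 1000 * #|D| by clear -leD n_large'; lia.
  have UD := leq_mul leU' leD'; have DD := leq_mul leD' leD'.
  have nn_gt0 : 0 < n * n by rewrite muln_gt0; clear -n_large'; lia.
  have HN := nonadj_le; rewrite -/N in HN.
  apply: triple_exists.
  - by clear -leU' n_large'; lia.
  - clear leQ2; move: leQ1 HN nm nn UD; rewrite -/n; move: (npairs Q1) N #|U| #|D| => q1 N' u d.
    clear; nia.
  - clear leQ1; move: nn_gt0 leQ2 HN nm nn DD; rewrite -/n; move: (npairs Q2) N #|D| => q2 N' d.
    clear; nia.
have adj_nx v : v \in c -> adj v (nx v).
  by move=> vc; have /and4P[] := tricycle_at Uc sz_gt2 tc vc.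
have adj_pv v : v \in c -> adj (pv v) v.
  by move=> vc; have /and4P[] := tricycle_at Uc sz_gt2 tc vc.
have nxc v : (nx v \in c) = (v \in c) by apply: mem_next.
have pvc v : (pv v \in c) = (v \in c) by apply: mem_prev.
have memU : [/\ z \in c, z != p & pv z != p].
  move: Uz; rewrite !inE => /and3P[zn -> ->]; split=> //.
  by apply: contraNneq zn => <-; rewrite pvK.
have memD v : v \in D -> [/\ adj x v, v \in c, v != p, nx v != p & pv v != p].
  rewrite !inE => /and4P[v1 v2 -> /andP[-> ->]]; split=> //.
    by apply: contraNneq v1 => <-; rewrite nxK.
  by apply: contraNneq v2 => <-; rewrite pvK.
pose r := rot (index z c) c.
have Ur : uniq r by rewrite rot_uniq.
have szr : size r = size c by rewrite size_rot.
have memr v : (v \in r) = (v \in c) by rewrite mem_rot.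
have tr : tricycle p triple_ok r by apply: tricycle_rot.
have nxr i : i.+1 < size r -> nth p r i.+1 = nx (nth p r i).
  by move=> lt; rewrite -(next_nth_S p Ur lt) next_rot.
have pvr i : i.+1 < size r -> nth p r i = pv (nth p r i.+1).
  by move=> lt; rewrite -(prev_nth_S p Ur lt) prev_rot.
have [zc zp pzp] := memU.
have r0 : nth p r 0 = z.
  by rewrite /r /rot (drop_nth p) ?index_mem //= nth_index.
have rk : nth p r (size r).-1 = pv z by rewrite -(prev_nth0 p Ur) r0 prev_rot.
have rk' : nth p r (size r).-2 = pv (pv z).
  by rewrite -rk pvr ?prednK //; rewrite szr; clear -sz_gt2; lia.
have x_p : x != p by apply: contraNneq xc => ->.
(* [u] and [u'] stand for [y] and [y'] in their order along [r]; the symmetry of [Q2] lets either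
   order be fed in. *)
have main u u' : u \in D -> u' \in D -> ~~ Q1 z u -> ~~ Q1 z u' ->
    ~~ Q2 u u' -> ~~ Q2 u' u -> index u r < index u' r ->
    exists c', tricycle p triple_ok c' /\ perm_eq c' (x :: r).
  move=> Du Du' Q1u Q1u' Q2u Q2u' lt_uu'.
  have [xu uc up nup pup] := memD _ Du; have [xu' u'c u'p nu'p pu'p] := memD _ Du'.
  move: Q1u Q1u' Q2u Q2u'; rewrite /Q1 /Q2 !negb_or !negbK.
  case/and5P=> zu wu bad1 bad2 /and5P[bad3 bad4 u_z u_nz /andP[u_w u_pw]].
  case/and5P=> zu' wu' bad1' bad2' /and5P[bad3' bad4' u'_z u'_nz /andP[u'_w u'_pw]].
  case/and5P=> _ _ bad5 _ /and5P[_ _ _ u'_u /and4P[u'_nu u'_nnu _ _]].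
  case/and5P=> nn pp _ bad6 /and5P[bad7 bad8 bad9 _ _].
  set i := index u r in lt_uu' *; set j := index u' r in lt_uu' *.
  have ri : nth p r i = u by rewrite nth_index ?memr.
  have rj : nth p r j = u' by rewrite nth_index ?memr.
  have lt_jr : j < size r by rewrite index_mem memr.
  have i_gt1 : 1 < i.
    case: (i) ri => [|[|i']] // ri; first by rewrite -ri r0 eqxx in u_z.
    by rewrite -ri nxr ?r0 ?eqxx ?szr // in u_nz; clear -sz_gt2; lia.
  have sz_gt2r : 2 < size r by rewrite szr.
  have ri1 : nth p r i.+1 = nx u by rewrite nxr ?ri // (leq_ltn_trans lt_uu').
  have ij2 : i.+2 <= j.
    rewrite ltn_neqAle lt_uu' andbT; apply: contraNneq u'_nu => eq_ij.
    by rewrite -rj -eq_ij ri1.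
  have ri2 : nth p r i.+2 = nx (nx u) by rewrite nxr ?ri1 // (leq_ltn_trans ij2).
  have ij : i + 3 <= j.
    rewrite addn3 ltn_neqAle ij2 andbT; apply: contraNneq u'_nnu => eq_ij.
    by rewrite -rj -eq_ij ri2.
  have j_ne1 : j != (size r).-1 by apply: contraNneq u'_w => eq_j; rewrite -rj eq_j rk.
  have j_ne2 : j != (size r).-2 by apply: contraNneq u'_pw => eq_j; rewrite -rj eq_j rk'.
  have jr : j + 3 <= size r by clear -j_ne1 j_ne2 lt_jr sz_gt2r; lia.
  have rj1 : nth p r j.+1 = nx u' by rewrite nxr ?rj //; clear -jr; lia.
  have rj2 : nth p r j.+2 = nx (nx u') by rewrite nxr ?rj1 //; clear -jr; lia.
  have pred_nth l v : l < size r -> nth p r l = v -> 0 < l -> nth p r l.-1 = pv v.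
    by case: l => // l lt_l <- _; rewrite -pvr.
  have ri1' : nth p r i.-1 = pv u.
    by apply: pred_nth ri _; clear -i_gt1 lt_uu' lt_jr; lia.
  have ri2' : nth p r i.-2 = pv (pv u).
    by apply: pred_nth ri1' _; clear -i_gt1 lt_uu' lt_jr; lia.
  have rj1' : nth p r j.-1 = pv u'.
    by apply: pred_nth rj _; clear -i_gt1 lt_uu' lt_jr; lia.
  have rj2' : nth p r j.-2 = pv (pv u').
    by apply: pred_nth rj1' _; clear -i_gt1 lt_uu' lt_jr; lia.
  have r1 : nth p r 1 = nx z by rewrite nxr ?r0 //; clear -sz_gt2r; lia.
  have wc : pv z \in c by rewrite pvc.
  apply: (tricycle_switch triple_ok_sym i_gt1 ij jr) => //.
  - by case/and3P: tr.
  - by rewrite r0 r1 ri; apply: triple_okI => //; rewrite adj_sym adj_nx.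
  - by rewrite r0 ri; apply: triple_okI => //; rewrite adj_sym.
  - by rewrite ri rj; apply: triple_okI => //; rewrite adj_sym.
  - by rewrite rk rj; apply: triple_okI => //; rewrite adj_sym.
  - by rewrite rk rk' rj; apply: triple_okI => //; rewrite 1?bad_sym // adj_sym ?adj_pv.
  - by rewrite rj1 rj2 ri1; apply: triple_okI => //; rewrite adj_sym ?adj_nx ?nxc.
  - by rewrite rj1 ri1 ri2; apply: triple_okI => //; rewrite 1?bad_sym ?adj_nx ?nxc // adj_sym.
  - by rewrite rj2' rj1' ri1'; apply: triple_okI => //; rewrite ?adj_pv ?pvc // adj_sym.
  - by rewrite rj1' ri1' ri2'; apply: triple_okI => //; rewrite 1?bad_sym // adj_sym ?adj_pv ?pvc.
have [c' [tc' perm_c']] : exists c', tricycle p triple_ok c' /\ perm_eq c' (x :: r).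
  have Q2y'y : ~~ Q2 y' y.
    move: Q2yy'; rewrite /Q2 (adj_sym (nx y')) (adj_sym (pv y')) (bad_sym x y') (eq_sym y y').
    rewrite !negb_or; case/and5P=> -> -> -> -> /and5P[-> -> -> -> /and4P[-> -> -> ->]].
    by [].
  have [lt|lt|eq_i] := ltngtP (index y r) (index y' r).
  - exact: (main y y').
  - exact: (main y' y).
  case: (memD _ Dy) => _ yc _ _ _; case/negP: Q2yy'; rewrite /Q2.
  have -> : y' = y by rewrite -(nth_index p (_ : y \in r)) ?memr // eq_i nth_index // memr; case: (memD _ Dy').
  by rewrite eqxx !orbT.
have perm_c : perm_eq c' (x :: c).
  by apply: perm_trans perm_c' _; rewrite perm_cons perm_rot.
by exists c'; split=> //; rewrite (perm_uniq perm_c) /= xc.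
Qed.

(** With at most n/10 vertices outside, any of them sends at least n/5 - n/10 edges to [c]. With
    more, if all failed, each would miss at least n/20 vertices of [c], giving about n^2/200
    nonadjacent pairs, more than n^2/600 + n. *)
Lemma outside_vertex c : uniq c -> 3 * n <= 20 * size c -> size c < n ->
  exists2 x, x \notin c & n <= 10 * #|[set y | adj x y && (y \in c)]|.
Proof.
move=> Uc sz_c lt_cn; pose C := [set z in c].
have cardC : #|C| = size c by rewrite cardsE; apply/card_uniqP.
have cardC' : size c + #|~: C| = n by rewrite -cardC cardsC.
have [/exists_inP[x Cx dx]|] := boolP [exists x in ~: C,
    n <= 10 * #|[set y | adj x y && (y \in c)]|].
  by exists x => //; rewrite !inE in Cx.
rewrite negb_exists_in => /forall_inP few.
have split_nbr a : #|[set y | adj a y]| =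
    #|[set y | adj a y && (y \in c)]| + #|[set y | adj a y && (y \notin c)]|.
  rewrite -(cardsID C); congr (_ + _); apply: eq_card => y; rewrite !inE //.
  by rewrite andbC.
have [le_out|lt_out] := leqP (10 * #|~: C|) n.
  have /card_gt0P[x Cx] : 0 < #|~: C| by clear -cardC' lt_cn; lia.
  have := few x Cx; have := deg_ge x; rewrite split_nbr.
  have : #|[set y | adj x y && (y \notin c)]| <= #|~: C|.
    by apply: subset_leq_card; apply/subsetP => y; rewrite !inE => /andP[].
  by clear -le_out; lia.
have : #|~: C| * (size c - n %/ 10) <= npairs (fun a b => ~~ adj a b).
  apply: npairs_ge => a Ca; have := few a Ca.
  have : #|C| = #|[set y | adj a y && (y \in c)]| + #|C :\: [set y | adj a y]|.
    rewrite -(cardsID [set y | adj a y] C); congr (_ + _); apply: eq_card => y.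
    by rewrite !inE andbC.
  have : #|C :\: [set y | adj a y]| <= #|[set b | ~~ adj a b]|.
    by apply: subset_leq_card; apply/subsetP => y; rewrite !inE => /andP[].
  by rewrite cardC; clear; lia.
have le1 : n <= 20 * (size c - n %/ 10) by clear -sz_c; lia.
have := leq_mul (ltnW lt_out) le1; have nn := leq_mul (leqnn n) n_large.
have n_gt0 : 0 < n by clear -n_large; lia.
have := nonadj_le.
move: (npairs _) (#|~: C|) (size c - _) => N a k; move: nn n_gt0.
clear; nia.
Qed.

(** * Greedy construction of a first cycle through the edge pq *)

Definition fresh a b (s : seq T) := [set x | [&& adj a x, x \notin s & ~~ bad a b x]].

(** A path ending in [b], [a] can be prolonged by any neighbour of [a], except for the vertices
    already used and at most [m] that clash with the edge [ab]. *)
Lemma fresh_ge a b (s : seq T) : n <= 5 * (#|fresh a b s| + size s + m).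
Proof.
apply: leq_trans (deg_ge a) _; rewrite leq_mul2l -addnA /=.
have sub : [set x | adj a x] \subset
    fresh a b s :|: ([set x in s] :|: [set x | bad a b x]).
  apply/subsetP => x; rewrite !inE => ->; case: (x \in s); case: (bad a b x) => //=.
apply: leq_trans (subset_leq_card sub) _.
apply: leq_trans (leq_card_setU _ _) _; rewrite leq_add2l.
apply: leq_trans (leq_card_setU _ _) _; rewrite leq_add ?bad_le //.
by rewrite cardsE card_size.
Qed.

Hypothesis adj_irr : irreflexive adj.
Hypothesis adj_pq : adj p q.

Lemma nth0_neq_last s : uniq s -> 1 < size s -> nth p s 0 != nth p (rev s) 0.
Proof.
move=> Us sz; have sz0 := ltnW sz.
by rewrite nth_rev // nth_uniq // ?subn1 ?prednK //; case: (size s) sz => [|[]].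
Qed.

(** The path grows at its head while its tail stays [q], [p]. A fresh vertex exists because 3n/20 +
    m < n/5, and the triple it creates is centred at the old head, which is not [p]. *)
Lemma path_exists k : 1 < k -> 20 * k <= 3 * n -> exists s,
  [/\ size s = k, uniq s, tri triple_ok s, adj (nth p s 0) (nth p s 1) &
      nth p (rev s) 0 = p /\ nth p (rev s) 1 = q].
Proof.
have n_large' := n_large; have m_small' := m_small.
elim: k => [|k IHk] //; case: (ltngtP k 1) => [|k_gt1 _ le_k|-> _ _]; first by clear; lia.
  have [|s [sz Us ts adj_s [s0 s1]]] := IHk k_gt1; first by clear -le_k; lia.
  have /card_gt0P[x] : 0 < #|fresh (nth p s 0) (nth p s 1) s|.
    have := fresh_ge (nth p s 0) (nth p s 1) s; rewrite sz.
    by clear -le_k n_large' m_small'; lia.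
  rewrite inE => /and3P[adjx xs badx].
  exists (x :: s); rewrite /= sz Us xs rev_cons !nth_rcons size_rev sz k_gt1 (ltnW k_gt1).
  split=> //; last by rewrite adj_sym.
  rewrite ts andbT; have := nth0_neq_last Us; rewrite sz s0 => /(_ k_gt1).
  case: (s) adjx adj_s badx => [|a [|b t]] //= adj_ax adj_ab bad_abx a_p.
  by apply: triple_okI; rewrite // 1?adj_sym 1?bad_sym.
exists [:: q; p]; split=> //=; last by rewrite adj_sym.
by rewrite inE andbT; apply: contraTneq adj_pq => ->; rewrite adj_irr.
Qed.

(** The path is closed by [u] after [p] and [v] before the head [a]. Each has at least 49n/1000
    candidates, so about 0.0024 n^2 pairs are available, while nonadjacency of [u], [v] and
    incompatibility at [u] or [v] exclude about n^2/600 + 2nm. *)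
Lemma cycle_start : exists c,
  [/\ uniq c, tricycle p triple_ok c, p \in c & 3 * n <= 20 * size c].
Proof.
have n_large' := n_large; have m_small' := m_small.
have k_gt1 : 1 < 3 * n %/ 20 by clear -n_large'; lia.
have le_k : 20 * (3 * n %/ 20) <= 3 * n by clear; lia.
have [s [sz Us ts adj_s [s0 s1]]] := path_exists k_gt1 le_k.
set a := nth p s 0 in adj_s; set b := nth p s 1 in adj_s.
pose R : rel T := fun u v => ~~ adj u v || (bad u p v || bad v a u).
have [/exists_inP[u Au /exists_inP[v Av Ruv]]|noR] := boolP [exists u in fresh p q s,
    [exists v in fresh a b s, ~~ R u v]].
  move: Au Av Ruv; rewrite !inE !negb_or negbK.
  case/and3P=> adj_pu us bad_u /and3P[adj_av vs bad_v] /and3P[adj_uv bad_upv bad_vau].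
  have ps : p \in s by rewrite -s0 -mem_rev mem_nth // size_rev sz ltnW.
  have u_p : u != p by apply: contraNneq us => ->.
  have v_p : v != p by apply: contraNneq vs => ->.
  have a_p : a != p.
    by rewrite -[X in _ != X]s0; apply: nth0_neq_last; rewrite ?sz.
  have ok1 : triple_ok q p u by rewrite /triple_ok adj_sym adj_pq adj_pu bad_u !eqxx.
  have ok2 : triple_ok p u v by apply: triple_okI.
  have ok3 : triple_ok u v a by apply: triple_okI; rewrite // 1?adj_sym // bad_sym.
  have ok4 : triple_ok v a b by apply: triple_okI; rewrite // 1?adj_sym // bad_sym.
  exists (s ++ [:: u; v]); split.
  - rewrite cat_uniq Us /= !inE orbF negb_or us vs andbT /=.
    by rewrite andbT; apply: contraTneq adj_uv => ->; rewrite adj_irr.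
  - rewrite /tricycle (tri_cat p) ?sz // ts s0 s1 rev_cat /=.
    by rewrite !nth_cat sz k_gt1 (ltnW k_gt1) ok1 ok2 ok3 ok4.
  - by rewrite mem_cat ps.
  - by rewrite size_cat sz /=; clear; lia.
have : #|fresh p q s| * #|fresh a b s| <= npairs R.
  apply: npairs_ge => u Au; apply: subset_leq_card; apply/subsetP => v Av.
  by rewrite inE; apply: contraR noR => Ruv; apply/exists_inP; exists u => //;
     apply/exists_inP; exists v.
have : npairs R <= npairs (fun a b => ~~ adj a b) + (n * m + n * m).
  apply: npairs_or_le => //; apply: npairs_or_le.
    by apply: npairs_le => u; apply: bad_le.
  by rewrite -npairs_swap; apply: npairs_le => v; apply: bad_le.
have le1 : 49 * n <= 1000 * #|fresh p q s|.
  by have := fresh_ge p q s; rewrite sz; clear -le_k n_large' m_small'; lia.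
have le2 : 49 * n <= 1000 * #|fresh a b s|.
  by have := fresh_ge a b s; rewrite sz; clear -le_k n_large' m_small'; lia.
have := leq_mul le1 le2; have nn := leq_mul (leqnn n) n_large.
have nm := leq_mul (leqnn n) m_small.
have nn_gt0 : 0 < n * n by rewrite muln_gt0; clear -n_large'; lia.
have := nonadj_le; move: nn nm nn_gt0.
move: (npairs R) (npairs _) (#|fresh p q s|) (#|fresh a b s|) => r N f1 f2.
clear; nia.
Qed.

Lemma hamilton_cycle_large : exists c,
  [/\ uniq c, forall v, v \in c & tricycle p triple_ok c].
Proof.
have [c0 [Uc0 tc0 pc0 sz_c0]] := cycle_start.
have le_n (c : seq T) : uniq c -> size c <= n by move=> Uc; rewrite -(card_uniqP Uc) max_card.
have full (c : seq T) : uniq c -> size c = n -> forall v, v \in c.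
  move=> Uc sz v; apply: contraT => vc.
  by have := le_n (v :: c); rewrite /= vc Uc sz ltnn => /(_ isT).
have [d def_d] : exists d, size c0 + d = n.
  by exists (n - size c0); rewrite subnKC ?le_n.
elim: d c0 Uc0 tc0 pc0 sz_c0 def_d => [|d IHd] c Uc tc pc sz_c def_n.
  by exists c; split=> //; apply: full; rewrite // -def_n addn0.
have [|x xc dx] := outside_vertex Uc sz_c; first by rewrite -def_n addnS ltnS leq_addr.
have [c' [Uc' tc' perm_c']] := cycle_extend Uc tc pc sz_c xc dx.
have sz_c' := perm_size perm_c'; rewrite /= in sz_c'.
apply: (IHd c') => //.
- by rewrite (perm_mem perm_c') inE pc orbT.
- by rewrite sz_c' (leq_trans sz_c) // leq_mul.
- by rewrite sz_c' -def_n addSnnS.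
Qed.

End Extension.

(** * Closure argument in the absence of incompatibilities *)

Section SortedSplits.
Variables (T : eqType) (e : rel T).

Lemma sorted_cat2 s a b t :
  sorted e (s ++ a :: b :: t) = [&& sorted e (rcons s a), e a b & sorted e (b :: t)].
Proof. by case: s => [|x s] //=; rewrite cat_path rcons_path /= -!andbA. Qed.

Lemma unsorted_split s : ~~ sorted e s ->
  exists s1 a b s2, s = s1 ++ a :: b :: s2 /\ ~~ e a b.
Proof.
elim: s => [|a [|b s] IHs] //=; rewrite negb_and => /orP[nab|/IHs].
  by exists [::], a, b, s.
by case=> s1 [c [d [s2 [-> ncd]]]]; exists (a :: s1), c, d, s2.
Qed.

Lemma two_opt s1 a b s2 c d s3 : symmetric e -> e a c -> e b d ->
  sorted e (rcons s1 a) -> sorted e (b :: rcons s2 c) -> sorted e (d :: s3) ->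
  sorted e (s1 ++ a :: c :: rev s2 ++ b :: d :: s3).
Proof.
move=> e_sym ac bd S1 S2 S3; rewrite sorted_cat2 S1 ac /=.
rewrite -[path _ _ _]/(sorted e ((c :: rev s2) ++ b :: d :: s3)) sorted_cat2 bd S3 !andbT.
by rewrite -rev_rcons -rev_cons rev_sorted (eq_sorted (fun x y => e_sym y x)).
Qed.

End SortedSplits.

Section Closure.
Variables (T : finType) (p q : T).
Let n := #|T|.
Implicit Types (adj : rel T).

Definition deg_of adj a := #|[set b | adj a b]|.

(** The edge [pq] will close such a path into a Hamilton cycle; keeping the ends fixed is what
    protects that edge during exchanges. *)
Definition ham_path adj :=
  exists s, [/\ uniq s, forall v, v \in s, sorted adj s, head q s = p & last p s = q].

(** If the path uses the added pair [u], [v], a 2-opt exchange removes it: some [a] has [u] adjacent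
    to [a] and [v] adjacent to the successor of [a]. *)
Lemma closure_step adj u v : symmetric adj -> irreflexive adj ->
  ~~ adj u v -> n + 2 <= deg_of adj u + deg_of adj v ->
  ham_path (fun a b => [|| adj a b, (a == u) && (b == v) | (a == v) && (b == u)]) ->
  ham_path adj.
Proof.
move=> adj_sym adj_irr nuv deg_uv [s [Us all_s sort_s head_s last_s]].
have [sort|unsort] := boolP (sorted adj s); first by exists s.
have [s1 [a [b [s2 [def_s nab]]]]] := unsorted_split unsort.
wlog [eq_a eq_b] : u v nuv deg_uv sort_s / a = u /\ b = v.
  move=> wl; move: (sort_s); rewrite def_s sorted_cat2 (negPf nab) /= => /and3P[_ ab _].
  case/orP: ab => /andP[/eqP eq_a /eqP eq_b]; first exact: (wl u v).
  apply: (wl v u); rewrite // 1?adj_sym // 1?[deg_of adj v + _]addnC //.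
  by apply: sub_sorted sort_s => x y /or3P[] ->; rewrite ?orbT.
subst a b; clear nab unsort.
(* A stretch of the path missing [u] or [v] cannot use the added pair. *)
have sort_sub t : sorted (fun a b => [|| adj a b, (a == u) && (b == v) | (a == v) && (b == u)]) t ->
    (u \notin t) || (v \notin t) -> sorted adj t.
  elim: t => [|x [|y t] IHt] //= /andP[xy sort_t] notin.
  have -> /= : path adj y t.
    by apply: IHt => //; move: notin; rewrite ![_ \in x :: _]inE !negb_or => /orP[]/andP[_ ->]; rewrite ?orbT.
  rewrite andbT; case/or3P: xy => // /andP[/eqP eq_x /eqP eq_y]; move: notin;
  by rewrite !inE eq_x eq_y !eqxx ?orbT.
move: sort_s; rewrite def_s sorted_cat2 => /and3P[sort1 _ sort2].
have Us'' : uniq (rcons s1 u ++ v :: s2) by rewrite cat_rcons -def_s.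
move: Us''; rewrite cat_uniq => /and3P[U1 disj U2].
have v1 : v \notin rcons s1 u by apply: contraNN disj => v1; rewrite /= v1.
have u2 : u \notin v :: s2.
  by apply: contraNN disj => u2; apply/hasP; exists u; rewrite ?mem_rcons ?mem_head.
have {}sort1 : sorted adj (rcons s1 u) by apply: sort_sub; rewrite ?v1 ?orbT.
have {}sort2 : sorted adj (v :: s2) by apply: sort_sub; rewrite ?u2.
have ps : p \in s by [].
have last_s' : last q s = q by case: (s) ps last_s.
have prev_p : prev s p = q.
  by rewrite -{1}head_s -nth0 (prev_nth0 q Us) nth_last.
(* As [next s q = p], both [X] and [Y] lie among the n - 1 vertices other than [p]. Their sizes sum
   to at least n + 2 - 2 = n, so they meet. *)
have [a [ua aq vb]] : exists a, [/\ adj u a, a != q & adj v (next s a)].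
  pose X := [set next s a | a in [set a | adj u a] :\ q].
  pose Y := [set b | adj v b] :\ p.
  have /set0Pn[b /setIP[/imsetP[a]]] : X :&: Y != set0.
    have sub : X :|: Y \subset [set~ p].
      apply/subsetP => b; rewrite !inE => /orP[/imsetP[a]|/andP[] //].
      rewrite !inE => /andP[aq _] ->; apply: contraNneq aq => eq_p.
      by rewrite -prev_p -eq_p prev_next.
    have := subset_leq_card sub; rewrite cardsC1 -/n.
    have := cardsUI X Y; rewrite card_imset; last exact: can_inj (prev_next Us).
    have : deg_of adj u <= #|[set a | adj u a] :\ q| + 1.
      by rewrite /deg_of (cardsD1 q) addnC leq_add2l; case: (_ \in _).
    have : deg_of adj v <= #|Y| + 1.
      by rewrite /deg_of (cardsD1 p) addnC leq_add2l; case: (_ \in _).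
    have n_gt0 : 0 < n by apply/card_gt0P; exists p.
    rewrite -card_gt0; move: deg_uv; clear -n_gt0; lia.
  by rewrite !inE => /andP[aq ua] -> /andP[_ vb]; exists a.
have next_split r1 r2 b : s = r1 ++ a :: b :: r2 -> next s a = b.
  move=> def_r; have r_a : nth q s (size r1) = a by rewrite def_r nth_cat ltnn subnn.
  have r_b : nth q s (size r1).+1 = b.
    by rewrite def_r nth_cat ltnNge leqnSn /= subSnn.
  by rewrite -r_a next_nth_S ?r_b // def_r size_cat /= !addnS !ltnS leq_addr.
have finish r1 x y r2 z w r3 : s = r1 ++ x :: y :: r2 ++ z :: w :: r3 ->
    adj x z -> adj y w -> sorted adj (rcons r1 x) -> sorted adj (y :: rcons r2 z) ->
    sorted adj (w :: r3) -> ham_path adj.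
  move=> def_r xz yw S1 S2 S3; exists (r1 ++ x :: z :: rev r2 ++ y :: w :: r3).
  have perm_s : perm_eq (r1 ++ x :: z :: rev r2 ++ y :: w :: r3) s.
    rewrite def_r; apply/permP => P; rewrite !(count_cat, count_rev) /= !(count_cat, count_rev) /=.
    by clear; lia.
  split.
  - by rewrite (perm_uniq perm_s).
  - by move=> c; rewrite (perm_mem perm_s).
  - exact: two_opt.
  - by move: head_s; rewrite def_r; case: (r1).
  - by move: last_s; rewrite def_r !last_cat /= !last_cat.
have : a \in s by []; rewrite def_s mem_cat !inE.
(* If [a] precedes [u], its successor is not [u], since [v] is not adjacent to [u]; if [a] follows
   [v], it has a successor on the path because it is not the end [q]. *)
case/or4P=> [a1|/eqP eq_a|/eqP eq_a|a2].
- case/splitPr: a1 def_s sort1 {U1 disj v1} => r1 r2 def_s sort1.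
  case: r2 def_s sort1 => [|b r2] def_s sort1.
    by move: vb; rewrite (next_split r1 (v :: s2) u) 1?adj_sym ?(negPf nuv) // def_s -catA.
  rewrite -catA /= in def_s; rewrite (next_split _ _ _ def_s) in vb.
  move: sort1; rewrite rcons_cat !rcons_cons sorted_cat2 => /and3P[S1 _ S2].
  by apply: finish def_s _ _ S1 S2 sort2; rewrite adj_sym.
- by rewrite eq_a adj_irr in ua.
- by rewrite eq_a (negPf nuv) in ua.
case/splitPr: a2 def_s sort2 {U2 disj u2} => r1 r2 def_s sort2.
case: r2 def_s sort2 => [|b r2] def_s sort2.
  by move: last_s' aq; rewrite def_s last_cat /= last_cat /= => ->; rewrite eqxx.
have := next_split (s1 ++ u :: v :: r1) r2 b; rewrite -catA /= => /(_ def_s) eq_b.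
move: sort2; rewrite -cat_cons sorted_cat2 => /and3P[S2 _ S3].
by rewrite eq_b in vb; apply: finish def_s ua vb sort1 S2 S3.
Qed.

(** All but n/120 vertices lie in [H], the set of degrees at least 3n/4. A nonadjacent pair inside
    [H] serves; otherwise [H] is a clique, and a pair with one end in [H] has degree sum at least
    |H| - 1 + n/5; otherwise [H] is joined to everything and [a0], [b0] serve. *)
Lemma close_pair adj a0 b0 : symmetric adj -> 
  600 * npairs (fun a b => (a != b) && ~~ adj a b) <= n * n ->
  (forall a, n <= 5 * deg_of adj a) -> a0 != b0 -> ~~ adj a0 b0 ->
  exists u v, [/\ u != v, ~~ adj u v & n + 2 <= deg_of adj u + deg_of adj v].
Proof.
move=> adj_sym le_NE deg_ge ab0 nab0.
(* The two orders of [a0], [b0] already give 1200 <= n^2. *)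
have n_ge : 35 <= n.
  have : #|[set a0; b0]| * 1 <= npairs (fun a b => (a != b) && ~~ adj a b).
    apply: npairs_ge => a; rewrite !inE => /orP[]/eqP->; apply/card_gt0P.
      by exists b0; rewrite inE ab0.
    by exists a0; rewrite inE eq_sym ab0 adj_sym.
  rewrite cards2 ab0 => ge2; move: le_NE; clear -ge2; nia.
pose H := [set a | 3 * n <= 4 * deg_of adj a].
pose nonnbr a := [set b | (a != b) && ~~ adj a b].
have deg_nonnbr a : n <= deg_of adj a + #|nonnbr a| + 1.
  have : [set: T] \subset [set b | adj a b] :|: nonnbr a :|: [set a].
    by apply/subsetP => b _; rewrite !inE (eq_sym b); case: (adj a b); case: eqP.
  move/subset_leq_card; rewrite cardsT => /leq_trans-> //.
  apply: leq_trans (leq_card_setU _ _) _; rewrite cards1 leq_add2r.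
  exact: leq_card_setU.
(* Each vertex outside [H] has at least (n - 3)/4 nonneighbours rounded down, hence at least n/5 as
   [n >= 35]. *)
have L_small : 120 * #|~: H| <= n.
  have : #|~: H| * ((n - 3) %/ 4) <= npairs (fun a b => (a != b) && ~~ adj a b).
    apply: npairs_ge => a; rewrite !inE -ltnNge -/(nonnbr a) => lowa.
    by have := deg_nonnbr a; clear -lowa; lia.
  have : n <= 5 * ((n - 3) %/ 4) by clear -n_ge; lia.
  have := le_NE; move: (npairs _) (_ %/ 4) => N k le1 le2 le3.
  clear -le1 le2 le3 n_ge; nia.
have cardH : #|H| + #|~: H| = n by apply: cardsC.
have deg_H (A : {set T}) a : (forall b, b \in A -> b != a -> adj a b) -> #|A| <= deg_of adj a + 1.
  move=> adjA; have : A \subset [set b | adj a b] :|: [set a].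
    apply/subsetP => b Ab; rewrite !inE; case: eqVneq => [|ne]; first by rewrite orbT.
    by rewrite adjA.
  move/subset_leq_card/leq_trans; apply.
  by apply: leq_trans (leq_card_setU _ _) _; rewrite cards1.
case: (boolP [exists u in H, [exists v in H, (u != v) && ~~ adj u v]]) => [|noHH].
  case/exists_inP=> u Hu /exists_inP[v Hv /andP[ne nuv]]; exists u, v; split=> //.
  by move: Hu Hv; rewrite !inE; clear -n_ge; lia.
have HH u v : u \in H -> v \in H -> u != v -> adj u v.
  move=> Hu Hv ne; apply: contraNT noHH => nuv; apply/exists_inP; exists u => //.
  by apply/exists_inP; exists v => //; rewrite ne.
case: (boolP [exists u in H, [exists v, (u != v) && ~~ adj u v]]) => [|noH].
  case/exists_inP=> u Hu /existsP[v /andP[ne nuv]]; exists u, v; split=> //.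
  have := deg_ge v; have : #|H| <= deg_of adj u + 1.
    by apply: deg_H => b Hb ne_b; apply: HH; rewrite // eq_sym.
  by clear -n_ge L_small cardH; lia.
have adjH u v : v \in H -> u != v -> adj u v.
  move=> Hv ne; rewrite adj_sym; apply: contraNT noH => nuv; apply/exists_inP; exists v => //.
  by apply/existsP; exists u; rewrite eq_sym ne.
exists a0, b0; split=> //.
have : #|H| <= deg_of adj a0 + 1 by apply: deg_H => b Hb ne; apply: adjH; rewrite // eq_sym.
have : #|H| <= deg_of adj b0 + 1 by apply: deg_H => b Hb ne; apply: adjH; rewrite // eq_sym.
by clear -n_ge L_small cardH; lia.
Qed.

(** Induction on the number of nonadjacent pairs: joining a pair from [close_pair] preserves both
    bounds, and [closure_step] undoes it. In the complete graph any ordering from [p] to [q]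
    works. *)
Lemma ham_path_exists adj : symmetric adj -> irreflexive adj -> p != q ->
  600 * npairs (fun a b => (a != b) && ~~ adj a b) <= n * n ->
  (forall a, n <= 5 * deg_of adj a) -> ham_path adj.
Proof.
move=> + + pq.
have [k] := ubnP (npairs (fun a b => (a != b) && ~~ adj a b)).
elim: k adj => // k IHk adj lt_k adj_sym adj_irr le_NE deg_ge.
have [|complete] := boolP [exists a, [exists b, (a != b) && ~~ adj a b]].
  case/existsP=> a0 /existsP[b0 /andP[ab0 nab0]].
  have [u [v [uv nuv deg_uv]]] := close_pair adj_sym le_NE deg_ge ab0 nab0.
  apply: (closure_step adj_sym adj_irr nuv deg_uv).
  set adj' := fun a b => _.
  have sub_adj a b : adj a b -> adj' a b by rewrite /adj' => ->.
  have lt_NE : npairs (fun a b => (a != b) && ~~ adj' a b) <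
               npairs (fun a b => (a != b) && ~~ adj a b).
    apply: (@npairs_ltn _ _ _ u v); rewrite ?uv /adj' ?eqxx ?orbT //.
    by move=> a b /andP[->]; rewrite negb_or => /andP[].
  apply: IHk.
  - exact: leq_trans lt_NE _.
  - by move=> a b; rewrite /adj' adj_sym; congr (_ || _); rewrite orbC ![(_ == v) && _]andbC.
  - move=> a; rewrite /adj' adj_irr /=; apply: contraNF uv.
    by case/orP=> /andP[/eqP<- /eqP<-].
  - by apply: leq_trans le_NE; rewrite leq_mul // ltnW.
  - move=> a; apply: leq_trans (deg_ge a) _; rewrite leq_mul //.
    by apply: subset_leq_card; apply/subsetP => b; rewrite !inE; apply: sub_adj.
have adjE a b : a != b -> adj a b.
  by move=> ne; apply: contraNT complete => nab; apply/existsP; exists a; apply/existsP; exists b; rewrite ne.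
pose s := p :: rcons [seq x <- enum T | (x != p) && (x != q)] q.
have Us : uniq s.
  rewrite cons_uniq rcons_uniq mem_rcons inE !mem_filter !eqxx andbF /=.
  by rewrite orbF pq filter_uniq ?enum_uniq.
exists s; split=> //.
- move=> v; rewrite inE mem_rcons inE mem_filter mem_enum andbT.
  by case: eqP => //= _; case: eqP.
- apply: pairwise_sorted; move: Us; rewrite uniq_pairwise; apply: sub_pairwise => a b /=.
  exact: adjE.
- by rewrite /= last_rcons.
Qed.

End Closure.

(** * From incompatibility systems to triples *)

Section Translation.
Variables (T : finType) (E : {set {set T}}) (F : T -> rel {set T}).
Let n := #|T|.
Hypothesis simpleE : simple_graph E.
Hypothesis deg_ge : forall v, n <= 5 * deg E v.
Hypothesis edges_ge : 1200 * 'C(n, 2) <= 1200 * #|E| + n * n.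
Hypothesis systemF : incompat_system E F.

Definition edge_rel (a b : T) := [set a; b] \in E.
Definition bad_at (b a c : T) := [&& edge_rel a b, edge_rel b c & in_F F b [set a; b] [set b; c]].

Lemma in_F_sym v e e' : in_F F v e e' = in_F F v e' e.
Proof. by rewrite /in_F orbC. Qed.

Lemma in_F_system v e e' : in_F F v e e' ->
  [/\ e \in E, e' \in E, e != e' & e :&: e' = [set v]].
Proof.
case/orP=> /systemF[] // e1 e2 ne eqv.
by rewrite eq_sym setIC.
Qed.

Lemma edge_rel_sym : symmetric edge_rel.
Proof. by move=> a b; rewrite /edge_rel setUC. Qed.

Lemma edge_rel_irr : irreflexive edge_rel.
Proof. by move=> a; apply/negP => /simpleE; rewrite setUid cards1. Qed.

Lemma bad_at_sym b a c : bad_at b a c = bad_at b c a.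
Proof.
by rewrite /bad_at in_F_sym !(edge_rel_sym _ b) andbCA (setUC [set a]) (setUC [set c]).
Qed.

Lemma edge_at e v : e \in E -> v \in e -> exists2 a, e = [set v; a] & edge_rel v a.
Proof.
move=> Ee ve; have /eqP/cards2P[x [y [xy def_e]]] := simpleE Ee.
move: ve; rewrite def_e !inE => /orP[]/eqP->; first by exists y; rewrite // /edge_rel -def_e.
by exists x; rewrite 1?setUC // /edge_rel setUC -def_e.
Qed.

Lemma in_F_bad v e e' : in_F F v e e' ->
  exists a c, [/\ e = [set a; v], e' = [set v; c] & bad_at v a c].
Proof.
move=> Fv; have [Ee Ee' _ eq_v] := in_F_system Fv.
have: v \in e :&: e' by rewrite eq_v set11.
case/setIP=> ve ve'; have [a def_e adj_a] := edge_at Ee ve.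
have [c def_e' adj_c] := edge_at Ee' ve'; exists a, c.
by rewrite /bad_at edge_rel_sym adj_a adj_c setUC -def_e -def_e' Fv.
Qed.

(** Distinct neighbours [c] of [b] give distinct edges [bc], so the bound on edges carries over to
    vertices. *)
Lemma bad_count b a m :
  (forall v e, e \in E -> v \in e ->
    #|[set e' in E | (v \in e') && (e' != e) && in_F F v e e']| <= m) ->
  #|[set c | bad_at b a c]| <= m.
Proof.
move=> le_m; have [adj_ab|nadj_ab] := boolP (edge_rel a b); last first.
  by rewrite (_ : [set c | _] = set0) ?cards0 //; apply/setP => c; rewrite !inE /bad_at (negPf nadj_ab).
apply: leq_trans (le_m b [set a; b] adj_ab _); last by rewrite !inE eqxx orbT.
rewrite -(card_in_imset (f := fun c => [set b; c])).
  apply: subset_leq_card; apply/subsetP => e /imsetP[c]; rewrite inE => /and3P[_ adj_bc Fb] ->.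
  by have [_ _ ne _] := in_F_system Fb; rewrite !inE -/(edge_rel b c) adj_bc eqxx Fb (eq_sym [set b; c]) ne.
move=> c c'; rewrite !inE => /and3P[_ adj_bc _] _ /setP/(_ c).
rewrite !inE eqxx orbT => /esym/orP[]/eqP // eq_c.
by move: adj_bc; rewrite eq_c edge_rel_irr.
Qed.

Lemma deg_le_nbr v : deg E v <= #|[set b | edge_rel v b]|.
Proof.
apply: leq_trans (leq_imset_card (fun b => [set v; b]) _).
apply: subset_leq_card; apply/subsetP => e; rewrite inE => /andP[Ee ve].
by have [a -> adj_a] := edge_at Ee ve; apply/imsetP; exists a; rewrite ?inE.
Qed.

Lemma sum_deg : \sum_v deg E v = 2 * #|E|.
Proof.
transitivity (\sum_(e in E) \sum_v (v \in e : nat)).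
  rewrite exchange_big; apply: eq_bigr => v _.
  rewrite /deg -sum1dep_card big_mkcondr; apply: eq_bigr => e _; by case: (v \in e).
rewrite mulnC -sum_nat_const; apply: eq_bigr => e /simpleE <-.
by rewrite sum_card cardsE.
Qed.

(** Ordered pairs count each missing edge twice, so a deficit of n^2/1200 becomes n^2/600. The
    diagonal is set apart here. *)
Lemma nonadj_proper_le : 600 * npairs (fun a b => (a != b) && ~~ edge_rel a b) <= n * n.
Proof.
have := @npairs_partition _ (fun a b => (a != b) && ~~ edge_rel a b) (fun a b => b == a) edge_rel.
have -> : npairs (fun a b : T => b == a) = n.
  rewrite /npairs -[RHS]muln1 -sum_nat_const; apply: eq_bigr => a _.
  by rewrite sum_card (_ : [set b | b == a] = [set a]) ?cards1 //; apply/setP => b; rewrite !inE.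
move=> /(_ _)/wrap[a b|]; first by case: (eqVneq a b) => [->|]; [rewrite edge_rel_irr | case: (edge_rel a b)].
have : 2 * #|E| <= npairs edge_rel.
  rewrite -sum_deg leq_sum // => v _; rewrite sum_card; exact: deg_le_nbr.
have := edges_ge; have : 'C(n, 2) * 2 = n * n.-1.
  by rewrite -[2]/(2`!) bin_ffact ffactnS ffactn1.
rewrite -/n; move: (n) => [|k] /=; first by clear; lia.
move: (npairs _) (npairs _) #|E| 'C(_, _) => N1 N2 e C.
clear; nia.
Qed.

Lemma nonadj_le : 600 * npairs (fun a b => ~~ edge_rel a b) <= n * n + 600 * n.
Proof.
apply: leq_trans (_ : 600 * (npairs (fun a b => (a != b) && ~~ edge_rel a b) + n) <= _).
  rewrite leq_mul2l /=; apply: leq_trans (leq_add (leqnn _) (npairs_fun id)).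
  apply: leq_trans (npairs_or _ _); apply: leq_sum => a _; apply: leq_sum => b _.
  by rewrite eq_sym; case: (eqVneq b a); case: (edge_rel a b).
by rewrite mulnDr leq_add2r nonadj_proper_le.
Qed.

(** For [m = 0] no triple is bad and the closure argument gives the cycle; otherwise n is large
    enough for the extension argument. *)
Lemma hamilton_compatible m p q :
  (forall v e, e \in E -> v \in e ->
    #|[set e' in E | (v \in e') && (e' != e) && in_F F v e e']| <= m) ->
  3 <= n -> 100 * (1000 * m) <= n -> (m = 0 \/ 100 * 1000 <= n) -> edge_rel p q ->
  exists c : seq T,
    [/\ hamilton_cycle E c, [set p; q] \in cycle_edges c & compatible_cycle F c].
Proof.
move=> le_m n_ge3 m_small m_case adj_pq.
have deg_ge' v : n <= 5 * #|[set b | edge_rel v b]|.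
  by apply: leq_trans (deg_ge v) _; rewrite leq_mul2l deg_le_nbr.
have bad_le b a := bad_count b a le_m.
have size_n (s : seq T) : uniq s -> (forall v, v \in s) -> size s = n.
  by move=> Us all_s; rewrite -(card_uniqP Us); apply: eq_card => v; rewrite all_s.
case: m_case => [m0|n_large].
  have pq : p != q by apply: contraTneq adj_pq => ->; rewrite edge_rel_irr.
  have [s [Us all_s sort_s head_s last_s]] :=
    ham_path_exists edge_rel_sym edge_rel_irr pq nonadj_proper_le deg_ge'.
  exists s; split.
  - split=> //; first by rewrite size_n.
    change (cycle edge_rel s); case: s {Us all_s} sort_s head_s last_s => [|x s] //= path_s eq_x.
    by rewrite -{}eq_x in adj_pq * => last_s; rewrite rcons_path path_s last_s edge_rel_sym.
  - apply/imsetP; exists q => //; rewrite setUC; congr [set _; _].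
    have last_s' : last q s = q by case: (s) (all_s p) last_s.
    have prev_p : prev s p = q by rewrite -{1}head_s -nth0 (prev_nth0 q Us) nth_last.
    by rewrite -prev_p next_prev.
  - move=> e e' _ _; apply/existsP => -[v /in_F_bad[a [c [_ _ bad_v]]]].
    have := bad_le v a; rewrite m0 leqn0 cards_eq0 => /eqP/setP/(_ c).
    by rewrite !inE bad_v.
have [c [Uc all_c tc]] := hamilton_cycle_large edge_rel_sym bad_at_sym bad_le nonadj_le deg_ge'
  n_large m_small edge_rel_irr adj_pq.
have sz : 2 < size c by rewrite size_n.
have ok_at v : triple_ok edge_rel bad_at p q (prev c v) v (next c v) by apply: tricycle_at tc _.
exists c; split.
- split=> //.
  have := cycle_next Uc; apply: sub_cycle => x y /eqP <-.
  by have /and4P[] := ok_at x.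
(* The last clause of [triple_ok] at [p] makes [q] a cycle neighbour of [p]. *)
- have /and4P[_ _ _] := ok_at p; rewrite eqxx /= => /orP[/eqP eq_q|/eqP eq_q].
    apply/imsetP; exists q => //; rewrite -eq_q next_prev // setUC //.
  by apply/imsetP; exists p; rewrite // eq_q.
move=> _ _ /imsetP[x _ ->] /imsetP[y _ ->]; apply/existsP => -[v Fv].
have nbad w : ~~ in_F F w [set prev c w; w] [set w; next c w].
  have /and4P[a1 a2 + _] := ok_at w; apply: contraNN => Fw.
  by rewrite /bad_at a1 a2.
(* Two incompatible cycle edges are distinct and share [v], so they enter and leave the cycle at
   [v], where the triple is good. *)
have [_ _ ne eq_v] := in_F_system Fv.
have : v \in [set x; next c x] :&: [set y; next c y] by rewrite eq_v set11.
rewrite !inE => /andP[/orP[]/eqP eq_x /orP[]/eqP eq_y].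
- by rewrite -eq_x -eq_y eqxx in ne.
- have := nbad v; rewrite in_F_sym.
  have -> : [set prev c v; v] = [set y; next c y] by rewrite eq_y prev_next.
  by rewrite {2 3}eq_x Fv.
- have := nbad v.
  have -> : [set prev c v; v] = [set x; next c x] by rewrite eq_x prev_next.
  by rewrite {2 3}eq_y Fv.
have eq_xy : x = y by apply: (can_inj (prev_next Uc)); rewrite -eq_x.
by rewrite eq_xy eqxx in ne.
Qed.

End Translation.

(** * From real parameters to integer bounds *)

Local Open Scope ring_scope.

Theorem theorem3p4 (R : realType) (beta mu : R) :
  0 < beta -> 0 < mu -> beta + 2 * Num.sqrt mu <= 1 / 1200 ->
  forall (T : finType) (E : {set {set T}}),
    simple_graph E ->
    (3 <= #|T|)%N ->
    (forall v : T, (#|T|%:R / 5 : R) <= (deg E v)%:R) ->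
    ('C(#|T|, 2))%:R - beta * (#|T|%:R) ^+ 2 <= (#|E|)%:R ->
    forall F : T -> rel {set T},
      incompat_system E F ->
      bounded E F (mu * #|T|%:R) ->
      forall e, e \in E ->
        exists c : seq T,
          [/\ hamilton_cycle E c, e \in cycle_edges c & compatible_cycle F c].
Proof.
move=> beta0 mu0 small T E simpleE n_ge3 deg_ge edges_ge F systemF boundF e Ee.
have sqrt0 : 0 <= Num.sqrt mu by apply: sqrtr_ge0.
have beta_le : beta <= 1 / 1200 by lra.
(* As [beta] is positive, the square root of [mu] is at most 1/2400, so [mu] is at most
   1/5760000. *)
have mu_le : 100 * (1000 * mu) <= 1.
  rewrite -[mu]sqr_sqrtr ?ltW // expr2.
  have : Num.sqrt mu <= 1 / 2400 by lra.
  nra.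
have n0 : 0 <= #|T|%:R :> R by apply: ler0n.
have deg_ge' v : (#|T| <= 5 * deg E v)%N.
  by rewrite -(ler_nat R) natrM; have := deg_ge v; lra.
have edges_ge' : (1200 * 'C(#|T|, 2) <= 1200 * #|E| + #|T| * #|T|)%N.
  rewrite -(ler_nat R) natrD !natrM; move: edges_ge n0; rewrite expr2.
  move: (#|T|%:R : R) ('C(_, 2)%:R : R) => t C; nra.
(* An integer at most [mu] n is at most this floor, which vanishes exactly when n < 10^5. *)
pose m := (#|T| %/ (100 * 1000))%N.
have /eqP/cards2P[p [q [_ def_e]]] := simpleE e Ee.
rewrite def_e; apply: (hamilton_compatible simpleE deg_ge' edges_ge' systemF (m := m)) => //.
- move=> v f Ef vf; rewrite leq_divRL //; have := boundF v f Ef vf.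
  move: #|_| => k le_k; rewrite -(ler_nat R) !natrM.
  move: le_k n0 mu_le; move: (#|T|%:R : R) (k%:R : R) => t k'; nra.
- by rewrite mulnA mulnC leq_trunc_div.
- by have [|lt] := leqP (100 * 1000) #|T|; [right | left; rewrite /m divn_small].
by rewrite /edge_rel -def_e.
Qed.
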